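(* For $n\ge7$ the moduli space $\mathbb M_n=\mathbb M_n(\mathbb C)$ is not a Hausdorff space.
   Context: An effective 1-cycle of degree $n$ in $\mathbb P^2(\mathbb C)$ is a formal sum $\sum m_j\mathcal C_j$ with distinct irreducible complex plane curves $\mathcal C_j$, integers $m_j\ge1$, and $\sum m_j\deg\mathcal C_j=n$. The space $\widehat{\mathfrak C}_n$ of all such cycles is identified with the projective space of nonzero homogeneous polynomials of degree $n$ in $x,y,z$ over $\mathbb C$ up to constants. The group $\mathbf G=\mathrm{PGL}_3(\mathbb C)$ acts on $\widehat{\mathfrak C}_n$; $\widehat{\mathfrak C}_n^{\mathsf{fs}}$ is the open subset of cycles with finite stabilizer in $\mathbf G$; and $\mathbb M_n=\widehat{\mathfrak C}_n^{\mathsf{fs}}/\mathbf G$ with the quotient topology. *)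

(* Defs.v *)
From HB Require Import structures.
(* The notations of [mpoly] clash with those of MathComp-Analysis; the ones
   used here are redeclared locally.  It comes first so that its [symmetric]
   and [measure] do not shadow the usual ones. *)
From mathcomp Require Import -(notations) mpoly.
From mathcomp Require Import all_boot all_order all_algebra.
From mathcomp Require Import complex.
From mathcomp Require Import all_classical all_reals all_analysis.
Import numFieldNormedType.Exports.

Set Implicit Arguments.
Unset Strict Implicit.
Unset Printing Implicit Defensive.

Import Order.TTheory GRing.Theory Num.Theory.

Local Open Scope classical_set_scope.
Local Open Scope quotient_scope.
Local Open Scope ring_scope.

Local Notation "{ 'mpoly' T [ n ] }" := (mpoly n T).
Local Notation "p @_ m" := (mcoeff m p) (at level 2, m at level 2).
Local Notation "'Xv_ i" := (mpolyX _ (mnm1 i)) (at level 8, i at level 2).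
Local Notation "p \mPo lq" := (comp_mpoly lq p) (at level 50).
Local Notation "n .-homog" := (@ishomog1 _ _ n mdeg) (at level 1).

(* [p (A x)], for [x] the column vector of the three variables. *)
Definition lin_subst (K : fieldType) (A : 'M[K]_3) (p : {mpoly K[3]}) :
    {mpoly K[3]} :=
  p \mPo [tuple \sum_(j < 3) A i j *: 'Xv_j | i < 3].

Lemma invmx_mul (K : fieldType) m (A B : 'M[K]_m) :
  A \in unitmx -> B \in unitmx -> invmx (A *m B) = invmx B *m invmx A.
Proof.
move=> uA uB; have uAB : A *m B \in unitmx by rewrite unitmx_mul uA.
by apply: (can_inj (mulKmx uAB)); rewrite mulmxV// -mulmxA mulKVmx// mulmxV.
Qed.

Section LinSubst.
Context (K : fieldType).
Implicit Types (A B : 'M[K]_3) (p : {mpoly K[3]}).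

Lemma lin_substZ A c p : lin_subst A (c *: p) = c *: lin_subst A p.
Proof. exact: comp_mpolyZ. Qed.

Lemma lin_subst0 A : lin_subst A 0 = 0.
Proof. exact: comp_mpoly0. Qed.

Lemma lin_subst1 p : lin_subst 1%:M p = p.
Proof.
rewrite -[RHS]comp_mpoly_id; congr (_ \mPo _).
apply: eq_from_tnth => i; rewrite !tnth_mktuple (bigD1 i)//= big1 => [|j ji].
  by rewrite mxE eqxx scale1r addr0.
by rewrite mxE eq_sym (negPf ji) scale0r.
Qed.

Lemma lin_substX A i :
  lin_subst A 'Xv_i = \sum_(j < 3) A i j *: 'Xv_j.
Proof. by rewrite /lin_subst comp_mpolyXU -tnth_nth tnth_mktuple. Qed.

Lemma lin_substM A B p : lin_subst (B *m A) p = lin_subst A (lin_subst B p).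
Proof.
rewrite [in RHS]/lin_subst [p \mPo _]comp_mpolyE raddf_sum /=.
rewrite {1}/lin_subst comp_mpolyE; apply: eq_bigr => m _.
rewrite comp_mpolyZ rmorph_prod /=; congr (_ *: _); apply: eq_bigr => i _.
rewrite rmorphXn /=; congr (_ ^+ _); rewrite !tnth_mktuple raddf_sum /=.
under [RHS]eq_bigr => j _ do
  rewrite comp_mpolyZ -/(lin_subst A _) lin_substX scaler_sumr.
rewrite exchange_big /=; apply: eq_bigr => j _.
rewrite mxE scaler_suml; apply: eq_bigr => k _.
by rewrite scalerA.
Qed.

Lemma lin_subst_scale A (c : K) n p : p \is n.-homog ->
  lin_subst (c *: A) p = c ^+ n *: lin_subst A p.
Proof.
move=> /dhomogP hp; rewrite /lin_subst !comp_mpolyE scaler_sumr.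
rewrite !big_seq; apply: eq_bigr => m mp.
have <- : mdeg m = n := hp _ mp; rewrite scalerA mulrC -scalerA; congr (_ *: _).
rewrite mdegE -prodrXr -scaler_prod; apply: eq_bigr => i _.
rewrite -exprZn; congr (_ ^+ _); rewrite !tnth_mktuple scaler_sumr.
by apply: eq_bigr => j _; rewrite mxE scalerA.
Qed.

Lemma lin_subst_homog A n p : p \is n.-homog -> lin_subst A p \is n.-homog.
Proof.
have lqh i : \sum_(j < 3) A i j *: ('Xv_j : {mpoly K[3]}) \is 1.-homog.
  apply: rpred_sum => j _; apply: dhomogZ; rewrite dhomogX; apply/eqP/mdeg1.
have homX q k : q \is 1.-homog -> (q ^+ k : {mpoly K[3]}) \is k.-homog.
  by move=> /(dhomogMn k); rewrite mul1n.
move=> /dhomogP hp; rewrite /lin_subst comp_mpolyE big_seq.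
apply: rpred_sum => m mp; apply: dhomogZ.
have <- : mdeg m = n := hp _ mp.
rewrite mdegE; elim/big_rec2: _ => [|i d q _ qd]; first exact: dhomog1.
by apply: dhomogM => //; apply: homX; rewrite tnth_mktuple.
Qed.

Lemma lin_subst_eq0 A p : A \in unitmx -> (lin_subst A p == 0) = (p == 0).
Proof.
move=> uA; apply/eqP/eqP => [Ap0|->]; last exact: lin_subst0.
by rewrite -[p]lin_subst1 -(mulmxV uA) lin_substM Ap0 lin_subst0.
Qed.

Lemma lin_subst_invM A B p : A \in unitmx -> B \in unitmx ->
  lin_subst (invmx (A *m B)) p = lin_subst (invmx A) (lin_subst (invmx B) p).
Proof. by move=> uA uB; rewrite invmx_mul// lin_substM. Qed.

End LinSubst.

Section Moduli.
Context (R : realType).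

Local Notation C := R[i].

Definition is_form (n : nat) (p : {mpoly C[3]}) : bool :=
  (p != 0) && (p \is n.-homog).

Definition nzform (n : nat) := {p : {mpoly C[3]} | is_form n p}.

HB.instance Definition _ n := Choice.on (nzform n).

(* Only the finitely many coefficients in degree [n] can be nonzero, so this
   induces the usual topology of a finite-dimensional complex vector space. *)
Definition form_coeff (n : nat) (p : nzform n) :
  prod_topology (fun _ : multinom 3 => C^o) := fun m => (val p)@_m.

HB.instance Definition _ n :=
  Topological.copy (nzform n) (initial_topology (@form_coeff n)).

Definition form_equiv (n : nat) (p q : nzform n) : bool :=
  `[< exists2 c : C, c != 0 & val q = c *: val p >].

Lemma form_equiv_refl n : reflexive (@form_equiv n).
Proof. by move=> p; apply/asboolP; exists 1; rewrite ?oner_neq0 ?scale1r. Qed.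

Lemma form_equiv_sym n : symmetric (@form_equiv n).
Proof.
have sub p q : @form_equiv n p q -> form_equiv q p.
  move=> /asboolP[c c0 qE]; apply/asboolP.
  exists c^-1; first by rewrite invr_eq0.
  by rewrite qE scalerA mulVf// scale1r.
by move=> p q; apply/idP/idP; apply: sub.
Qed.

Lemma form_equiv_trans n : transitive (@form_equiv n).
Proof.
move=> q p r /asboolP[c c0 qE] /asboolP[d d0 rE]; apply/asboolP.
by exists (d * c); rewrite ?mulf_neq0// rE qE scalerA.
Qed.

Canonical form_equiv_rel n := EquivRel (@form_equiv n)
  (@form_equiv_refl n) (@form_equiv_sym n) (@form_equiv_trans n).

(* The space of effective 1-cycles of degree [n]: the cycle
   [\sum_j m_j C_j] is the class of [\prod_j f_j ^+ m_j], where [f_j] is an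
   equation of [C_j]. *)
Definition eff_cycle (n : nat) := quotient_topology {eq_quot @form_equiv_rel n}.

HB.instance Definition _ n := Topological.on (eff_cycle n).
HB.instance Definition _ n := Quotient.on (eff_cycle n).

Definition GL3 := {A : 'M[C]_3 | A \in unitmx}.

HB.instance Definition _ := Choice.on GL3.

Lemma GL3_unit (A : GL3) : val A \in unitmx. Proof. exact: valP. Qed.

Definition GL3_equiv (A B : GL3) : bool :=
  `[< exists2 c : C, c != 0 & val B = c *: val A >].

Lemma GL3_equiv_refl : reflexive GL3_equiv.
Proof. by move=> p; apply/asboolP; exists 1; rewrite ?oner_neq0 ?scale1r. Qed.

Lemma GL3_equiv_sym : symmetric GL3_equiv.
Proof.
have sub p q : GL3_equiv p q -> GL3_equiv q p.
  move=> /asboolP[c c0 qE]; apply/asboolP.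
  exists c^-1; first by rewrite invr_eq0.
  by rewrite qE scalerA mulVf// scale1r.
by move=> p q; apply/idP/idP; apply: sub.
Qed.

Lemma GL3_equiv_trans : transitive GL3_equiv.
Proof.
move=> q p r /asboolP[c c0 qE] /asboolP[d d0 rE]; apply/asboolP.
by exists (d * c); rewrite ?mulf_neq0// rE qE scalerA.
Qed.

Canonical GL3_equiv_rel := EquivRel GL3_equiv
  GL3_equiv_refl GL3_equiv_sym GL3_equiv_trans.

Definition PGL3 := {eq_quot GL3_equiv_rel}.

HB.instance Definition _ := Quotient.on PGL3.
HB.instance Definition _ := Choice.on PGL3.

Lemma is_form_act n (A : GL3) (p : nzform n) :
  is_form n (lin_subst (invmx (val A)) (val p)).
Proof.
have /andP[p0 ph] := valP p.
by rewrite /is_form lin_subst_eq0 ?unitmx_inv ?GL3_unit// p0 lin_subst_homog.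
Qed.

(* [A . p = p \o A^-1], so that the zero set of [A . p] is the image under [A]
   of the zero set of [p]. *)
Definition form_act n (A : GL3) (p : nzform n) : nzform n :=
  exist _ (lin_subst (invmx (val A)) (val p)) (is_form_act A p).

Definition PGL3_act n (g : PGL3) (x : eff_cycle n) : eff_cycle n :=
  \pi_(eff_cycle n) (form_act (repr g) (repr x)).

Lemma cycle_eqP n (p q : nzform n) :
  \pi_(eff_cycle n) p = \pi_(eff_cycle n) q <->
  exists2 c : C, c != 0 & val q = c *: val p.
Proof.
split=> [/(@eqmodP _ (@form_equiv_rel n))/asboolP//|pq].
exact/(@eqmodP _ (@form_equiv_rel n))/asboolP.
Qed.

Lemma PGL3_eqP (A B : GL3) :
  \pi_PGL3 A = \pi_PGL3 B <-> exists2 c : C, c != 0 & val B = c *: val A.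
Proof.
split=> [/(@eqmodP _ GL3_equiv_rel)/asboolP//|AB].
exact/(@eqmodP _ GL3_equiv_rel)/asboolP.
Qed.

Lemma PGL3_actE n (A : GL3) (p : nzform n) :
  PGL3_act (\pi_PGL3 A) (\pi_(eff_cycle n) p) =
  \pi_(eff_cycle n) (form_act A p).
Proof.
apply/esym/cycle_eqP.
have /esym/PGL3_eqP[a a0 AE] := reprK (\pi_PGL3 A).
have /esym/cycle_eqP[b b0 pE] := reprK (\pi_(eff_cycle n) p).
exists ((a^-1) ^+ n * b); first by rewrite mulf_neq0// expf_neq0// invr_eq0.
rewrite /= AE pE lin_substZ invmxZ; last by rewrite -AE; exact: valP.
rewrite (@lin_subst_scale _ _ _ n) ?scalerA 1?mulrC//.
by have /andP[] := valP p.
Qed.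

Definition GL3_one : GL3 := exist _ 1%:M (@unitmx1 _ _).

Lemma GL3_mul_subproof (A B : GL3) : val A *m val B \in unitmx.
Proof. by rewrite unitmx_mul !GL3_unit. Qed.

Definition GL3_mul (A B : GL3) : GL3 :=
  exist _ (val A *m val B) (GL3_mul_subproof A B).

Lemma GL3_inv_subproof (A : GL3) : invmx (val A) \in unitmx.
Proof. by rewrite unitmx_inv GL3_unit. Qed.

Definition GL3_inv (A : GL3) : GL3 :=
  exist _ (invmx (val A)) (GL3_inv_subproof A).

Lemma PGL3_act1 n (x : eff_cycle n) : PGL3_act (\pi_PGL3 GL3_one) x = x.
Proof.
rewrite -[x]reprK PGL3_actE; congr (\pi _).
by apply: val_inj; rewrite /= invmx1 lin_subst1.
Qed.

Lemma PGL3_actM n (A B : GL3) (x : eff_cycle n) :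
  PGL3_act (\pi_PGL3 (GL3_mul A B)) x =
  PGL3_act (\pi_PGL3 A) (PGL3_act (\pi_PGL3 B) x).
Proof.
rewrite -[x]reprK [PGL3_act (\pi B) _]PGL3_actE !PGL3_actE.
congr (\pi _); apply: val_inj.
exact: (lin_subst_invM _ (GL3_unit A) (GL3_unit B)).
Qed.

Lemma PGL3_actK n (A : GL3) (x : eff_cycle n) :
  PGL3_act (\pi_PGL3 (GL3_inv A)) (PGL3_act (\pi_PGL3 A) x) = x.
Proof.
have AVA : GL3_mul (GL3_inv A) A = GL3_one.
  by apply: val_inj; exact: mulVmx (GL3_unit A).
by rewrite -(PGL3_actM (GL3_inv A) A x) AVA; exact: PGL3_act1.
Qed.

Definition stabilizer n (x : eff_cycle n) : set PGL3 :=
  [set g | PGL3_act g x = x].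

(* As a type, a set carries the subspace topology. *)
Definition fs_cycle (n : nat) : set (eff_cycle n) :=
  [set x | finite_set (stabilizer x)].
Arguments fs_cycle : clear implicits.

Definition orbit_equiv n (x y : fs_cycle n) : bool :=
  `[< exists g : PGL3, PGL3_act g (val x) = val y >].

Lemma orbit_equiv_refl n : reflexive (@orbit_equiv n).
Proof.
by move=> x; apply/asboolP; exists (\pi_PGL3 GL3_one); exact: PGL3_act1.
Qed.

Lemma orbit_equiv_sym n : symmetric (@orbit_equiv n).
Proof.
have sub x y : @orbit_equiv n x y -> orbit_equiv y x.
  move=> /asboolP[g gx]; apply/asboolP; exists (\pi_PGL3 (GL3_inv (repr g))).
  by rewrite -gx -[in PGL3_act g _](reprK g); exact: PGL3_actK.
by move=> x y; apply/idP/idP; apply: sub.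
Qed.

Lemma orbit_equiv_trans n : transitive (@orbit_equiv n).
Proof.
move=> y x z /asboolP[g gx] /asboolP[h hy]; apply/asboolP.
exists (\pi_PGL3 (GL3_mul (repr h) (repr g))).
by rewrite (PGL3_actM (repr h) (repr g)) !reprK gx.
Qed.

Canonical orbit_equiv_rel n := EquivRel (@orbit_equiv n)
  (@orbit_equiv_refl n) (@orbit_equiv_sym n) (@orbit_equiv_trans n).

Definition moduli (n : nat) := quotient_topology {eq_quot @orbit_equiv_rel n}.

HB.instance Definition _ n := Topological.on (moduli n).
HB.instance Definition _ n := Quotient.on (moduli n).

End Moduli.

Arguments fs_cycle : clear implicits.

(* Main.v *)
From mathcomp Require Import -(notations) mpoly.
Require Import Defs.
From mathcomp Require Import all_boot all_order all_algebra.
From mathcomp Require Import complex.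
From mathcomp Require Import all_classical all_reals all_analysis.
Import numFieldNormedType.Exports.

(** A one-parameter subgroup of the projective group relates two curves of
    cycles which have inequivalent limits, both with finite stabilizer. Put
    [k = n - 4] and consider the cycles
      [F(s, t) = y z (s x + y + z) (x + t y) x ^ k],
    which are products of linear forms. Substituting [t x] for [x] turns
    [F(1, t)] into [t ^ (k + 1) F(t, 1)], so for [t != 0] the cycles [F(1, t)]
    and [F(t, 1)] lie in the same orbit ([PGL3_act_five_form]). As [t] tends to
    [0] they converge to [F(1, 0)] and [F(0, 1)] respectively. If the moduli
    space were Hausdorff, two continuous curves in it that agree for [t != 0]
    would agree at [0] ([hausdorff_eq_at]), so these two limits would be in the
    same orbit. But the support of [F(1, 0)] consists of four lines and that of
    [F(0, 1)] of five ([five_lines_not_equivalent]).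

    All the cycles involved have finite stabilizer. Linear forms are prime
    ([line_product_factor]), so an element of the stabilizer permutes the lines
    of the cycle. For [(s, t) != (0, 0)], a linear map preserving each line of
    [F(s, t)] is scalar ([five_lines_rigid]); hence an element of the
    stabilizer is determined by the way it permutes finitely many lines
    ([rigid_finite_stabilizer]).

    A line is represented throughout by the row vector of the coefficients of
    an equation. Linear substitution by [A] is then right multiplication by
    [A], and for nonzero [u] and [v] the relation [(u <= v)%MS] says that [u]
    and [v] are equations of the same line. *)

Set Implicit Arguments.
Unset Strict Implicit.
Unset Printing Implicit Defensive.

Import Order.TTheory GRing.Theory Num.Theory.

Local Open Scope classical_set_scope.
Local Open Scope quotient_scope.
Local Open Scope ring_scope.

Local Notation "{ 'mpoly' T [ n ] }" := (mpoly n T).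
Local Notation "p @_ m" := (mcoeff m p) (at level 2, m at level 2).
Local Notation "'Xv_ i" := (mpolyX _ (mnm1 i)) (at level 8, i at level 2).
Local Notation "n .-homog" := (@ishomog1 _ _ n mdeg) (at level 1).

(** * Products of linear forms *)

Section LineProducts.
Context (K : fieldType).
Implicit Types (u v : 'rV[K]_3) (s : seq 'rV[K]_3) (A B D : 'M[K]_3).

Definition linear_form u : {mpoly K[3]} := \sum_(j < 3) u 0 j *: 'Xv_j.

Definition line_product s : {mpoly K[3]} := \prod_(u <- s) linear_form u.

Lemma linear_formD u v : linear_form (u + v) = linear_form u + linear_form v.
Proof.
by rewrite -big_split; apply: eq_bigr => j _; rewrite mxE scalerDl.
Qed.

Lemma linear_formZ c u : linear_form (c *: u) = c *: linear_form u.
Proof. by rewrite scaler_sumr; apply: eq_bigr => j _; rewrite mxE scalerA. Qed.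

Lemma linear_form_eq0 u : (linear_form u == 0) = (u == 0).
Proof.
apply/eqP/eqP => [u0|->]; last first.
  by rewrite -(scale0r 0) linear_formZ scale0r.
apply/rowP => j; rewrite mxE; have := congr1 (mcoeff (mnm1 j)) u0.
rewrite mcoeff0 raddf_sum /= (bigD1 j)//= mcoeffZ mcoeffX eqxx mulr1.
rewrite big1 ?addr0// => i ij; rewrite mcoeffZ mcoeffX.
by rewrite eq_mnm1 (negPf ij) mulr0.
Qed.

Lemma linear_form_homog u : linear_form u \is 1.-homog.
Proof.
by apply: rpred_sum => j _; apply: dhomogZ; rewrite dhomogX; apply/eqP/mdeg1.
Qed.

Lemma line_product_homog s : line_product s \is (size s).-homog.
Proof.
rewrite /line_product; elim: s => [|u s IH].
  by rewrite big_nil; exact: dhomog1.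
by rewrite big_cons; exact: (dhomogM (linear_form_homog u) IH).
Qed.

Lemma line_product_neq0 s : 0 \notin s -> line_product s != 0.
Proof.
move=> s0; rewrite /line_product prodf_seq_neq0; apply/allP => u us /=.
by rewrite linear_form_eq0; apply: contraNneq s0 => <-.
Qed.

Lemma line_product_cat s s' :
  line_product (s ++ s') = line_product s * line_product s'.
Proof. exact: big_cat. Qed.

Lemma line_product_cons u s :
  line_product (u :: s) = linear_form u * line_product s.
Proof. exact: big_cons. Qed.

(** A product of linear forms is linear in each of its factors, hence affine
    along a pencil described by a single factor. *)
Lemma line_product_affine s s' u v t :
  line_product (s ++ (u + t *: v) :: s') =
  line_product (s ++ u :: s') + t *: line_product (s ++ v :: s').
Proof.
rewrite !line_product_cat !line_product_cons linear_formD linear_formZ.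
by rewrite mulrDl mulrDr -!scalerAl -scalerAr.
Qed.

Lemma line_product_nseqZ c u k :
  line_product (nseq k (c *: u)) = c ^+ k *: line_product (nseq k u).
Proof.
elim: k => [|k IH] /=; first by rewrite /line_product !big_nil scale1r.
rewrite !line_product_cons IH linear_formZ.
by rewrite -scalerAl -scalerAr scalerA exprS.
Qed.

Lemma lin_subst_linear_form A u :
  lin_subst A (linear_form u) = linear_form (u *m A).
Proof.
rewrite [in LHS]/linear_form /lin_subst raddf_sum /=.
under eq_bigr => i _ do
  rewrite comp_mpolyZ -/(lin_subst A _) lin_substX scaler_sumr.
rewrite exchange_big; apply: eq_bigr => j _.
by rewrite mxE scaler_suml; apply: eq_bigr => i _; rewrite scalerA.
Qed.

Lemma lin_subst_line_product A s :
  lin_subst A (line_product s) = line_product [seq u *m A | u <- s].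
Proof.
rewrite /line_product big_map /lin_subst rmorph_prod /=.
by apply: eq_bigr => u _; rewrite -/(lin_subst A _) lin_subst_linear_form.
Qed.

(** Linear forms are prime. The matrix [cokermx v] kills exactly the multiples
    of [v] among row vectors, so substituting it, which is a ring morphism into
    a domain, annihilates [linear_form v], hence one of the factors on the
    left, and that factor must be proportional to [v]. *)
Lemma line_product_factor s s' c v : line_product s = c *: line_product s' ->
  v \in s' -> exists2 u, u \in s & (u <= v)%MS.
Proof.
move=> ss' vs'.
have : line_product [seq u *m cokermx v | u <- s] = 0.
  rewrite -lin_subst_line_product ss' lin_substZ lin_subst_line_product.
  rewrite /line_product (perm_big _ (perm_map _ (perm_to_rem vs'))) /= big_cons.
  have /eqP-> : linear_form (v *m cokermx v) == 0.
    by rewrite mulmx_coker linear_form_eq0.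
  by rewrite mul0r scaler0.
move/eqP; rewrite /line_product big_map prodf_seq_eq0 => /hasP[u us /=].
by rewrite linear_form_eq0 -submxE => uv; exists u.
Qed.

End LineProducts.

(** * Rigid systems of lines and finite stabilizers *)

Section Rigidity.
Context (K : fieldType).
Implicit Types (u v : 'rV[K]_3) (s : seq 'rV[K]_3) (A B D : 'M[K]_3).

Definition rigid s := forall D, (forall u, u \in s -> (u *m D <= u)%MS) ->
  is_scalar_mx D.

Lemma sub_row_sym (u v : 'rV[K]_3) : u != 0 -> (u <= v)%MS -> (v <= u)%MS.
Proof.
move=> u0 /sub_rVP[a ua]; apply/sub_rVP; exists a^-1.
have a0 : a != 0 by apply: contraNneq u0 => a0; rewrite ua a0 scale0r.
by rewrite ua scalerA mulVf// scale1r.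
Qed.

(** If [A] and [B] send the same line [u] of the system to each line [v], then
    [A^-1 B] preserves every line of the system, so it is scalar. *)
Lemma rigid_unique s A B : rigid s -> 0 \notin s ->
  A \in unitmx -> B \in unitmx ->
  (forall v, v \in s ->
    exists2 u, u \in s & (u *m A <= v)%MS && (u *m B <= v)%MS) ->
  exists2 c, c != 0 & B = c *: A.
Proof.
move=> rs s0 uA uB AB.
have : is_scalar_mx (invmx A *m B).
  apply: rs => v vs; have [u us /andP[uAv uBv]] := AB _ vs.
  have uA0 : u *m A != 0.
    apply: contraNneq s0 => uA0.
    by rewrite -(mul0mx _ (invmx A)) -uA0 mulmxK.
  rewrite mulmxA; apply: submx_trans uBv; apply: submxMr.
  by rewrite -[X in (_ <= X)%MS](mulmxK uA); apply: submxMr; exact: sub_row_sym.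
move=> /is_scalar_mxP[c cE]; exists c; last first.
  by rewrite -(mulKVmx uA B) cE mul_mx_scalar.
apply: contraTneq uB => c0; rewrite -(mulKVmx uA B) cE c0 mul_mx_scalar.
by rewrite scale0r unitmxE det0 unitr0.
Qed.

End Rigidity.

Section LineCycles.
Context (R : realType) (n : nat).
Local Notation C := R[i].
Implicit Types (p q : nzform R n) (s : seq 'rV[C]_3).

(** The inverse matrix appears because [g] acts on a form by substitution of
    [g^-1]. *)
Lemma PGL3_act_lines (g : PGL3 R) p q s s' :
  val p = line_product s -> val q = line_product s' ->
  PGL3_act g (\pi_(eff_cycle R n) p) = \pi_(eff_cycle R n) q ->
  forall v, v \in s' ->
    exists2 u, u \in s & (u *m invmx (val (repr g)) <= v)%MS.
Proof.
move=> ps qs'; rewrite -{1}[g]reprK PGL3_actE => /esym/cycle_eqP[c c0 /= eqc].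
move: eqc; rewrite ps qs' lin_subst_line_product => eqc v vs'.
have [_ /mapP[u us ->] uv] := line_product_factor eqc vs'.
by exists u.
Qed.

(** Rigidity makes the stabilizer inject into the finite set of partial maps
    of the set of lines to itself. *)
Lemma rigid_finite_stabilizer p s : val p = line_product s -> 0 \notin s ->
  rigid s -> finite_set (stabilizer (\pi_(eff_cycle R n) p)).
Proof.
move=> ps s0 rs; set S := stabilizer _.
pose inv (g : PGL3 R) := invmx (val (repr g)).
(* [f g v] is a line that [g] sends to [v]. *)
pose f (g : PGL3 R) : {ffun seq_sub s -> option (seq_sub s)} :=
  [ffun v => [pick u | (val u *m inv g <= val v)%MS]].
have f_inj : {in S &, injective f}.
  move=> g h; rewrite !inE => Sg Sh fgh.
  have ug : inv g \in unitmx by rewrite unitmx_inv; exact: valP.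
  have uh : inv h \in unitmx by rewrite unitmx_inv; exact: valP.
  have [v vs|c c0 hE] := rigid_unique rs s0 ug uh.
    have := congr1 (fun F : {ffun _} => F (SeqSub vs)) fgh; rewrite !ffunE.
    case: pickP => [u ugv|nog] eqgh; last first.
      have [u us ug'] := PGL3_act_lines ps ps Sg vs.
      by have := nog (SeqSub us); rewrite ug'.
    move: eqgh; case: pickP => // u' u'hv [uu'].
    by exists (val u); [exact: valP | rewrite ugv uu'].
  rewrite -[g]reprK -[h]reprK; apply/PGL3_eqP; exists c^-1.
    by rewrite invr_eq0.
  by rewrite -[LHS]invmxK -/(inv h) hE invmxZ -?hE// invmxK.
by rewrite -(eq_finite_set (inj_card_eq f_inj)); exact: finite_finset.
Qed.

End LineCycles.

(** * Continuous families of cycles *)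

Lemma hausdorff_eq_at (K : numFieldType) (T : topologicalType)
    (f g : K^o -> T) (x : K^o) : hausdorff_space T ->
  continuous f -> continuous g -> (forall t, t != x -> f t = g t) -> f x = g x.
Proof.
move=> hT cf cg fg.
have fx : f @ x^' --> f x by exact: cvg_within_filter (cf x).
have gx : g @ x^' --> g x by exact: cvg_within_filter (cg x).
apply: (@cvg_unique _ hT (f @ x^')) => //.
apply: cvg_trans gx; apply: near_eq_cvg.
by near=> t; apply/esym/fg; near: t; exact: nbhs_dnbhs_neq.
Unshelve. all: by end_near. Qed.

Lemma affine_continuous (K : numFieldType) (a b : K) :
  continuous (fun t : K^o => a + t * b : K^o).
Proof.
by move=> t; apply: cvgD (@mulrr_continuous K b t); exact: cvg_cst.
Qed.

(** A family of forms is continuous as soon as each coefficient is, and here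
    the coefficients are affine functions of the parameter. *)
Lemma affine_nzform_continuous (R : realType) n (f : R[i]^o -> nzform R n) a b :
  (forall t, val (f t) = a + t *: b) -> continuous f.
Proof.
move=> fE; apply: continuous_comp_initial => t.
have FF : Filter ((@form_coeff R n \o f) @ t).
  by apply: fmap_filter; exact: nbhs_filter.
apply/cvg_sup => m.
apply: (@continuous_comp_initial _ R[i]^o R[i]^o
  (fun h : multinom 3 -> R[i]^o => h m)).
rewrite (_ : _ \o _ = fun t : R[i]^o => a@_m + t * b@_m); last first.
  by apply/funext => u /=; rewrite /form_coeff fE mcoeffD mcoeffZ.
exact: affine_continuous.
Qed.

Lemma moduli_continuous (R : realType) n (f : R[i]^o -> nzform R n)
    (ffs : forall t, fs_cycle R n (\pi_(eff_cycle R n) (f t))) :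
  continuous f ->
  continuous (fun t =>
    \pi_(moduli R n) (exist _ (\pi_(eff_cycle R n) (f t)) (mem_set (ffs t)))).
Proof.
move=> cf; pose F t : fs_cycle R n :=
  exist _ (\pi_(eff_cycle R n) (f t)) (mem_set (ffs t)).
have cF : continuous F.
  apply: continuous_comp_initial => t.
  exact: (continuous_comp (cf t) (@pi_continuous _ _ (f t))).
move=> t; exact: (continuous_comp (cF t) (@pi_continuous _ _ (F t))).
Qed.

(** * A two-parameter system of five lines *)

Section FiveLines.
Context (K : fieldType).
Implicit Types (a b c s t : K) (k : nat) (D : 'M[K]_3).

Definition row3 a b c : 'rV[K]_3 := \row_(j < 3) [:: a; b; c]`_j.

Lemma row3D a b c a' b' c' :
  row3 a b c + row3 a' b' c' = row3 (a + a') (b + b') (c + c').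
Proof. by apply/rowP; case=> [[|[|[|]]] ?] //; rewrite !mxE. Qed.

Lemma row3Z t a b c : t *: row3 a b c = row3 (t * a) (t * b) (t * c).
Proof. by apply/rowP; case=> [[|[|[|]]] ?] //; rewrite !mxE. Qed.

Lemma row3_inj a b c a' b' c' :
  row3 a b c = row3 a' b' c' -> [/\ a = a', b = b' & c = c'].
Proof.
move=> /rowP e; have := (e (inord 0), e (inord 1), e (inord 2)).
by rewrite !mxE !inordK//= => -[[-> ->] ->].
Qed.

Lemma row3_eq a b c a' b' c' :
  (row3 a b c == row3 a' b' c') = [&& a == a', b == b' & c == c'].
Proof.
by apply/eqP/and3P => [/row3_inj[-> -> ->]|[/eqP-> /eqP-> /eqP->]].
Qed.

Lemma row3_eq0 a b c : (row3 a b c == 0) = [&& a == 0, b == 0 & c == 0].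
Proof.
have -> : 0 = row3 0 0 0 by apply/rowP; case=> [[|[|[|]]] ?] //; rewrite !mxE.
exact: row3_eq.
Qed.

Lemma row3_mul a b c D : row3 a b c *m D =
  a *: row (inord 0) D + b *: row (inord 1) D + c *: row (inord 2) D.
Proof.
apply/rowP => j; rewrite !mxE !big_ord_recl big_ord0 !mxE /= addr0 addrA.
by congr (_ * D _ _ + _ * D _ _ + _ * D _ _); apply: val_inj; rewrite /= inordK.
Qed.

(** The lines of the cycle [F(s, t)] above: [y], [z], [s x + y + z],
    [x + t y], and [k] times [x]. *)
Definition five_lines s t k : seq 'rV[K]_3 :=
  [:: row3 0 1 0; row3 0 0 1; row3 s 1 1; row3 1 t 0] ++ nseq k (row3 1 0 0).

Lemma five_lines_neq0 s t k : 0 \notin five_lines s t k.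
Proof.
by rewrite mem_cat mem_nseq !inE !(eq_sym 0) !row3_eq0 !oner_eq0 /= !andbF.
Qed.

(** A matrix preserving the three coordinate lines is diagonal. Preserving
    [s x + y + z] makes its last two entries equal, and the first entry equals
    the second because of [s x + y + z] if [s != 0], and of [x + t y] if
    [t != 0]. *)
Lemma five_lines_rigid s t k : (0 < k)%N -> (s != 0) || (t != 0) ->
  rigid (five_lines s t k).
Proof.
move=> k0 st D hD.
have eig u : u \in five_lines s t k -> exists d, u *m D = d *: u.
  by move=> /hD/sub_rVP.
have [|d1] := eig (row3 1 0 0).
  by rewrite mem_cat mem_nseq k0 eqxx orbT.
have [|d2] := eig (row3 0 1 0); first by rewrite inE eqxx.
have [|d3] := eig (row3 0 0 1); first by rewrite !inE eqxx ?orbT.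
have [|d4] := eig (row3 s 1 1); first by rewrite !inE eqxx ?orbT.
have [|d5] := eig (row3 1 t 0); first by rewrite !inE eqxx ?orbT.
rewrite !row3_mul !scale0r !scale1r !addr0 !add0r => + + D2 D1 D0.
rewrite D0 D1 D2 !row3Z !row3D !mulr0 !mulr1 !addr0 !add0r.
move=> /row3_inj[e1 e2 _] /row3_inj[e3 e4 e5].
have d32 : d3 = d2 by rewrite e4 e5.
have d12 : d1 = d2.
  case/orP: st => [s0|t0].
    by apply: (mulIf s0); rewrite [LHS]mulrC e3 -e4.
  by apply: (mulIf t0); rewrite e1 -e2 mulrC.
apply/is_scalar_mxP; exists d2; apply/matrixP => i j.
have -> : D i j = row (inord i) D 0 j by rewrite mxE inord_val.
by case: i j => [[|[|[|]]] i] // [[|[|[|]]] j] //; rewrite [in LHS]/=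
  ?(D0, D1, D2, d12, d32) !mxE /= ?(mulr1, mulr0).
Qed.

(** Scaling [x] by [t] scales the [k] factors [x] by [t], and turns [x + t y]
    into [t (x + y)]: this accounts for the exponent [k.+1]. *)
Lemma five_lines_degenerate t k :
  line_product [seq u *m diag_mx (row3 t 1 1) | u <- five_lines 1 t k] =
  t ^+ k.+1 *: line_product (five_lines t 1 k).
Proof.
have rowE a b c : row3 a b c *m diag_mx (row3 t 1 1) = row3 (t * a) b c.
  apply/rowP => j; rewrite mul_mx_diag !mxE.
  by case: j => [[|[|[|]]] ?] //=; rewrite ?mulr1// mulrC.
rewrite map_cat map_nseq /= !rowE !mulr0 !mulr1.
have -> : row3 t t 0 = t *: row3 1 1 0 by rewrite row3Z !mulr1 mulr0.
have -> : row3 t 0 0 = t *: row3 1 0 0 by rewrite row3Z mulr1 !mulr0.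
rewrite !line_product_cons line_product_nseqZ linear_formZ.
by rewrite -!(scalerAl, scalerAr) scalerA -exprS.
Qed.

Lemma five_lines_affinel t k : exists a b : {mpoly K[3]}, forall s',
  line_product (five_lines s' t k) = a + s' *: b.
Proof.
pose L1 := [:: row3 0 1 0; row3 0 0 1].
pose L2 := row3 1 t 0 :: nseq k (row3 1 0 0).
exists (line_product (L1 ++ row3 0 1 1 :: L2)).
exists (line_product (L1 ++ row3 1 0 0 :: L2)) => s'.
by rewrite -line_product_affine row3Z row3D !mulr0 !mulr1 !addr0 add0r.
Qed.

Lemma five_lines_affiner s k : exists a b : {mpoly K[3]}, forall t,
  line_product (five_lines s t k) = a + t *: b.
Proof.
pose L1 := [:: row3 0 1 0; row3 0 0 1; row3 s 1 1].
pose L2 := nseq k (row3 1 0 0).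
exists (line_product (L1 ++ row3 1 0 0 :: L2)).
exists (line_product (L1 ++ row3 0 1 0 :: L2)) => t.
by rewrite -line_product_affine row3Z row3D !mulr0 !mulr1 !addr0 add0r.
Qed.

(** Comparing vectors with entries in [{0, 1}] is a cheap way to see that the
    lines of [five_lines 0 1 k] are pairwise distinct. *)
Lemma sub_zero_one_row (u v : 'rV[K]_3) :
  (forall j, u 0 j \in [:: 0; 1]) -> (forall j, v 0 j \in [:: 0; 1]) ->
  u != 0 -> (u <= v)%MS -> u = v.
Proof.
move=> u01 v01 /rV0Pn[j uj] /sub_rVP[c uE]; rewrite uE.
move: uj (u01 j) (v01 j); rewrite !inE => /negPf-> /=; rewrite uE mxE.
move=> /eqP cv1 /orP[] /eqP vj; move: cv1; rewrite vj ?(mulr0, mulr1).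
  by move/eqP; rewrite eq_sym oner_eq0.
by move=> ->; rewrite scale1r.
Qed.

(** The five distinct lines of [five_lines 0 1 k] would come from distinct
    lines of [five_lines 1 0 k], where [x + t y] has become [x] and only four
    distinct lines are left. *)
Lemma five_lines_not_equivalent k D : (0 < k)%N -> D \in unitmx ->
  ~ forall v, v \in five_lines 0 1 k ->
      exists2 u, u \in five_lines 1 0 k & (u *m D <= v)%MS.
Proof.
move=> k0 uD H.
pose W : seq 'rV[K]_3 :=
  [:: row3 0 1 0; row3 0 0 1; row3 0 1 1; row3 1 1 0; row3 1 0 0].
pose V : seq 'rV[K]_3 :=
  [:: row3 0 1 0; row3 0 0 1; row3 1 1 1; row3 1 0 0].
have W01 v : v \in W -> forall j, v 0 j \in [:: 0; 1].
  have row01 (b1 b2 b3 : bool) j :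
      row3 b1%:R b2%:R b3%:R 0 j \in [:: 0; 1 : K].
    rewrite !inE !mxE.
    by case: b1; case: b2; case: b3; case: j => [[|[|[|]]] i] //=;
      rewrite eqxx ?orbT.
  by rewrite !inE; do 4?[case/orP => [/eqP->|]]; last move=> /eqP->;
    [ exact: (row01 false true false) | exact: (row01 false false true)
    | exact: (row01 false true true) | exact: (row01 true true false)
    | exact: (row01 true false false)].
have H' v : exists u, v \in W -> u \in V /\ (u *m D <= v)%MS.
  case: (boolP (v \in W)) => [vW|]; last by exists 0.
  have [|u uL uv] := H v.
    by move: vW; rewrite mem_cat mem_nseq k0 /= !inE -!orbA.
  exists u => _; split=> //.
  move: uL; rewrite mem_cat mem_nseq k0 /= !inE -!orbA.
  by repeat (case/orP => [->|]; rewrite ?orbT//); move=> ->; rewrite ?orbT.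
have [phi phiP] := choice H'.
suff : (size (map phi W) <= size V)%N by [].
apply: uniq_leq_size => [|u /mapP[v vW ->]]; last by have [] := phiP v vW.
rewrite map_inj_in_uniq.
  by rewrite /= !inE !row3_eq !(eq_sym 0) !oner_eq0 !eqxx.
move=> v w vW wW vw.
have [[uV uDv] [_ uDw]] := (phiP _ vW, phiP _ wW).
rewrite -vw in uDw.
apply: sub_zero_one_row (W01 _ vW) (W01 _ wW) _ _.
  apply: contraTneq vW => ->.
  by rewrite !inE !(eq_sym 0) !row3_eq0 oner_eq0 !andbF.
apply: submx_trans uDw; apply: sub_row_sym => //.
apply: contraTneq uV => u0; rewrite -[phi v](mulmxK uD) u0 mul0mx.
by rewrite !inE !(eq_sym 0) !row3_eq0 oner_eq0 !andbF.
Qed.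

End FiveLines.

(** * Two inequivalent limits *)

Section Degeneration.
Context (R : realType) (n : nat) (n_gt4 : (4 < n)%N).
Local Notation C := R[i].
Local Notation k := (n - 4)%N.

Lemma five_lines_is_form (s t : C) :
  is_form n (line_product (five_lines s t k)).
Proof.
rewrite /is_form line_product_neq0 ?five_lines_neq0//=.
have := line_product_homog (five_lines s t k).
by rewrite size_cat size_nseq subnKC// ltnW.
Qed.

Definition five_form s t : nzform R n :=
  exist _ (line_product (five_lines s t k)) (five_lines_is_form s t).

Lemma five_form_fs s t : (s != 0) || (t != 0) ->
  fs_cycle R n (\pi_(eff_cycle R n) (five_form s t)).
Proof.
move=> st; apply: (@rigid_finite_stabilizer _ _ _ (five_lines s t k)) => //.
  exact: five_lines_neq0.
by apply: five_lines_rigid => //; rewrite subn_gt0.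
Qed.

Lemma PGL3_act_five_form t : t != 0 ->
  exists g, PGL3_act g (\pi_(eff_cycle R n) (five_form 1 t)) =
    \pi_(eff_cycle R n) (five_form t 1).
Proof.
move=> t0; pose L : 'M[C]_3 := diag_mx (row3 t 1 1).
have uL : invmx L \in unitmx.
  rewrite unitmx_inv unitmxE det_diag !big_ord_recl big_ord0 !mxE /=.
  by rewrite !mulr1 unitfE.
exists (\pi_(PGL3 R) (exist _ (invmx L) uL)); rewrite PGL3_actE.
apply/esym/cycle_eqP; exists (t ^+ k.+1); first by rewrite expf_neq0.
by rewrite /= invmxK lin_subst_line_product five_lines_degenerate.
Qed.

End Degeneration.

Theorem proposition6p1 (R : realType) (n : nat) (hn : (7 <= n)%N) :
  ~ hausdorff_space (moduli R n).
Proof.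
move=> hM; have n4 : (4 < n)%N by apply: leq_trans hn.
pose P : R[i]^o -> nzform R n := fun t => five_form n4 1 t.
pose Q : R[i]^o -> nzform R n := fun t => five_form n4 t 1.
have fsP t : fs_cycle R n (\pi_(eff_cycle R n) (P t)).
  by apply: five_form_fs; rewrite oner_neq0.
have fsQ t : fs_cycle R n (\pi_(eff_cycle R n) (Q t)).
  by apply: five_form_fs; rewrite oner_neq0 orbT.
have cP : continuous P.
  have [a [b PE]] := five_lines_affiner (1 : R[i]) (n - 4).
  exact: (@affine_nzform_continuous R n P a b).
have cQ : continuous Q.
  have [a [b QE]] := five_lines_affinel (1 : R[i]) (n - 4).
  exact: (@affine_nzform_continuous R n Q a b).
have PQ (t : R[i]^o) : t != 0 ->
    \pi_(moduli R n) (exist _ (\pi_(eff_cycle R n) (P t)) (mem_set (fsP t))) =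
    \pi_(moduli R n) (exist _ (\pi_(eff_cycle R n) (Q t)) (mem_set (fsQ t))).
  move=> t0; apply/(@eqmodP _ (@orbit_equiv_rel R n))/asboolP.
  exact: PGL3_act_five_form.
have := hausdorff_eq_at hM (moduli_continuous (ffs := fsP) cP)
  (moduli_continuous (ffs := fsQ) cQ) PQ.
move=> /(@eqmodP _ (@orbit_equiv_rel R n))/asboolP[g /= gPQ].
(* At the parameter 0 the two curves pass through the limit cycles. *)
have k0 : (0 < n - 4)%N by rewrite subn_gt0.
apply: (five_lines_not_equivalent k0 _ (PGL3_act_lines _ _ gPQ)) => //.
by rewrite unitmx_inv; exact: valP.
Qed.
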